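(* For every real $a\ge16$, $$e_a\le\frac{5}{2\sqrt a}.$$
   Context: For $a>0$ let $p_{a,1}(x)=\frac1{\Gamma(a)}x^{a-1}e^{-x}$, $x>0$, be the density of the Gamma distribution with shape $a$ and scale $1$. For $x,y>0$ put $P_{a,1}(x)=\int_0^xp_{a,1}(u)\,du$, $\overline P_{a,1}(x)=\int_x^\infty p_{a,1}(u)\,du$, $\underline{\mathrm P}^1_{a,1}(x)=\int_0^xP_{a,1}(u)\,du$, $\overline{\mathrm P}^1_{a,1}(x)=\int_x^\infty\overline P_{a,1}(u)\,du$, $\underline M_{a,1}(y)=\frac{P_{a,1}(y)}{y\,p_{a,1}(y)}$, $\overline M_{a,1}(y)=\frac{\overline P_{a,1}(y)}{y\,p_{a,1}(y)}$ (smooth on $(0,\infty)$). For $z>0$ set $$C_{a,1}^2(z)=\overline M_{a,1}''(z)\int_0^z\underline{\mathrm P}^1_{a,1}(x)\,dx+\underline M_{a,1}''(z)\int_z^\infty\overline{\mathrm P}^1_{a,1}(x)\,dx,$$ and $e_a:=\sup_{z>0}C_{a,1}^2(z)$. *)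

(* Defs.v *)
From Stdlib Require Import Reals.
From Coquelicot Require Import Coquelicot.
Open Scope R_scope.

(* Both integrals are improper Riemann integrals.  For a < 1 the Gamma density
   is unbounded at 0; moreover the functions below are only meaningful on
   (0, +oo), and at_right 0 never evaluates them outside it. *)
Definition int0 (f : R -> R) (x : R) : R :=
  RInt_gen f (at_right 0) (at_point x).

Definition int_infty (f : R -> R) (x : R) : R :=
  RInt_gen f (at_point x) (Rbar_locally p_infty).

Definition Gamma (a : R) : R :=
  RInt_gen (fun t => Rpower t (a - 1) * exp (- t))
    (at_right 0) (Rbar_locally p_infty).

Definition gamma_pdf (a x : R) : R :=
  / Gamma a * Rpower x (a - 1) * exp (- x).

Definition gamma_cdf (a x : R) : R := int0 (gamma_pdf a) x.

Definition gamma_sf (a x : R) : R := int_infty (gamma_pdf a) x.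

Definition gamma_cdf1 (a x : R) : R := int0 (gamma_cdf a) x.

Definition gamma_sf1 (a x : R) : R := int_infty (gamma_sf a) x.

Definition M_low (a y : R) : R := gamma_cdf a y / (y * gamma_pdf a y).

Definition M_up (a y : R) : R := gamma_sf a y / (y * gamma_pdf a y).

Definition C2 (a z : R) : R :=
  Derive_n (M_up a) 2 z * int0 (gamma_cdf1 a) z +
  Derive_n (M_low a) 2 z * int_infty (gamma_sf1 a) z.

(* The supremum is taken in the extended reals, so that e_ a <= c with c real
   includes the boundedness of C2 a. *)
Definition e_ (a : R) : Rbar :=
  Lub_Rbar (fun c => exists z : R, 0 < z /\ c = C2 a z).

(* Main.v *)
Require Import Defs.
From Stdlib Require Import Reals Lra.
From Coquelicot Require Import Coquelicot.
Open Scope R_scope.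

(** Write [w = z - a], [D = w^2 + a] and [q = z p(z)], where [p] is the density.
    Since [z q' = - w q], we have [z M_low' = 1 + w M_low] and
    [z M_up' = - 1 + w M_up], hence [z^2 M_low'' = w - 1 + D M_low =: A] and
    [z^2 M_up'' = - (w - 1) + D M_up =: B].  The double integrals in [C2] are, up
    to a factor, the same expressions: they equal [q A / 2] and [q B / 2].
    Therefore [C2 = q A B / z^2], and since [q A + q B = D] with [A, B >= 0], we
    get [C2 <= D B / z^2], used for [z >= a], and [C2 <= D A / z^2], used for
    [z <= a].  It remains to bound [M_up] and [M_low] from above by explicit
    functions that satisfy the corresponding differential inequalities: a
    rational one for [|w| >= sqrt a], and an affine one for [|w| <= sqrt a] that
    matches it at [|w| = sqrt a].  The kernel is left unnormalised below, which
    replaces [q A + q B = D] by [q A + q B = D Gamma(a)]. *)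

(** * Limits, monotonicity, and improper integrals through antiderivatives *)

Lemma filterlim_squeeze_0 (F : (R -> Prop) -> Prop) {FF : Filter F} (f g : R -> R) :
  F (fun x => Rabs (f x) <= g x) ->
  filterlim g F (locally 0) -> filterlim f F (locally 0).
Proof.
intros Hle Hg P [eps HP].
assert (Hg' := Hg _ (locally_ball (0 : R) eps)).
unfold filtermap in *.
generalize (filter_and _ _ Hle Hg'); apply filter_imp.
intros x [H1 H2]; apply HP.
change (Rabs (g x - 0) < eps) in H2; change (Rabs (f x - 0) < eps).
rewrite Rminus_0_r in *.
apply Rle_lt_trans with (1 := H1), Rle_lt_trans with (2 := H2), Rle_abs.
Qed.

Lemma filterlim_plus_0 (F : (R -> Prop) -> Prop) {FF : Filter F} (f g : R -> R) :
  filterlim f F (locally 0) -> filterlim g F (locally 0) ->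
  filterlim (fun x => f x + g x) F (locally 0).
Proof.
intros Hf Hg; rewrite <- (Rplus_0_l 0).
apply (filterlim_comp_2 (G := locally (0 : R)) (H := locally (0 : R)) f g Rplus Hf Hg).
apply (filterlim_plus (0 : R) (0 : R)).
Qed.

Lemma filterlim_scal_0 (F : (R -> Prop) -> Prop) (c : R) (f : R -> R) :
  filterlim f F (locally 0) -> filterlim (fun x => c * f x) F (locally 0).
Proof.
intros Hf; rewrite <- (Rmult_0_r c).
apply (filterlim_comp _ _ _ f (Rmult c) F (locally 0)); [exact Hf|].
apply (filterlim_scal_r c (0 : R)).
Qed.

Lemma nondecreasing_of_derive (F f : R -> R) (x y : R) : x <= y ->
  (forall t, x <= t <= y -> is_derive F t (f t)) ->
  (forall t, x <= t <= y -> 0 <= f t) -> F x <= F y.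
Proof.
intros Hxy HF Hf.
destruct (MVT_gen F x y f) as [c [Hc E]].
- rewrite Rmin_left, Rmax_right by lra; intros t Ht; apply HF; lra.
- rewrite Rmin_left, Rmax_right by lra; intros t Ht.
  apply continuity_pt_filterlim; change (continuous F t).
  apply (ex_derive_continuous F); exists (f t); apply HF; lra.
- rewrite Rmin_left, Rmax_right in Hc by lra.
  assert (0 <= f c * (y - x)) by (apply Rmult_le_pos; [apply Hf; lra|lra]); lra.
Qed.

Lemma filterlim_at_right (f : R -> R) (x l : R) :
  filterlim f (locally x) (locally l) -> filterlim f (at_right x) (locally l).
Proof.
intros Hf P HP; generalize (Hf P HP); unfold filtermap, at_right, within.
apply filter_imp; auto.
Qed.

Lemma at_right_0_below (b : R) : 0 < b -> at_right 0 (fun x => 0 < x <= b).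
Proof.
intros Hb; exists (mkposreal b Hb); intros y Hy Hy0.
change (Rabs (y - 0) < b) in Hy; rewrite Rminus_0_r in Hy.
apply Rabs_def2 in Hy; lra.
Qed.

(** [F] is nondecreasing on (0, b], so [F b] dominates its limit at 0. The limit takes the place of
    an initial value, as the functions compared later are controlled only on (0, +oo). *)
Lemma nonneg_of_derive_at_0 (F f : R -> R) (b : R) : 0 < b ->
  (forall x, 0 < x <= b -> is_derive F x (f x)) ->
  (forall x, 0 < x <= b -> 0 <= f x) ->
  filterlim F (at_right 0) (locally 0) -> 0 <= F b.
Proof.
intros Hb HF Hf Hlim.
apply (filterlim_le (F := at_right 0) F (fun _ => F b) (Finite 0) (Finite (F b))).
- generalize (at_right_0_below b Hb); apply filter_imp; intros x Hx.
  apply nondecreasing_of_derive with f; [lra| |]; intros t Ht; [apply HF|apply Hf]; lra.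
- exact Hlim.
- apply filterlim_const.
Qed.

Lemma nonneg_of_derive_at_infty (F f : R -> R) (b : R) :
  (forall x, b <= x -> is_derive F x (f x)) ->
  (forall x, b <= x -> f x <= 0) ->
  filterlim F (Rbar_locally p_infty) (locally 0) -> 0 <= F b.
Proof.
intros HF Hf Hlim.
apply (filterlim_le (F := Rbar_locally p_infty) F (fun _ => F b) (Finite 0) (Finite (F b))).
- exists b; intros x Hx; apply Ropp_le_cancel.
  apply (nondecreasing_of_derive (fun t => - F t) (fun t => - f t)); [lra| |]; intros t Ht.
  + apply (is_derive_opp F), HF; lra.
  + assert (H := Hf t); lra.
- exact Hlim.
- apply filterlim_const.
Qed.

Lemma filterlim_bounded_nondecreasing (F : R -> R) (M : R) :
  (forall x y, 0 < x <= y -> F x <= F y) -> (forall x, 0 < x -> F x <= M) ->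
  exists l, filterlim F (Rbar_locally p_infty) (locally l) /\ (forall x, 0 < x -> F x <= l).
Proof.
intros Hmon HM.
destruct (completeness (fun c => exists x, 0 < x /\ c = F x)) as [l [Hub Hlub]].
- exists M; intros c [x [Hx ->]]; apply HM, Hx.
- exists (F 1), 1; split; [lra|reflexivity].
- assert (Hl : forall x, 0 < x -> F x <= l) by (intros x Hx; apply Hub; exists x; auto).
  exists l; split; [|exact Hl].
  intros P [eps HP].
  destruct (Classical_Prop.classic (exists x, 0 < x /\ l - eps < F x)) as [[x [Hx Hx2]]|Hn].
  + exists x; intros y Hy; apply HP; change (Rabs (F y - l) < eps).
    assert (F x <= F y) by (apply Hmon; lra).
    assert (F y <= l) by (apply Hl; lra).
    apply Rabs_def1; destruct eps; simpl in *; lra.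
  + exfalso; assert (l <= l - eps); [|destruct eps; simpl in *; lra].
    apply Hlub; intros c [x [Hx ->]].
    destruct (Rle_lt_dec (F x) (l - eps)) as [H|H]; [exact H|].
    exfalso; apply Hn; exists x; auto.
Qed.

(** Two integrands appear because [f] will often itself be an improper integral, known only through
    its closed form [g] on the positive half-line. Continuity is required of [g] alone. *)
Lemma is_RInt_gen_antiderivative (F f g : R -> R) (Fa Fb : (R -> Prop) -> Prop)
  {FFa : Filter Fa} {FFb : Filter Fb} (la lb : R) :
  Fa (fun x => 0 < x) -> Fb (fun x => 0 < x) ->
  (forall x, 0 < x -> f x = g x) ->
  (forall x, 0 < x -> is_derive F x (g x)) ->
  (forall x, 0 < x -> continuous g x) ->
  filterlim F Fa (locally la) -> filterlim F Fb (locally lb) ->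
  is_RInt_gen f Fa Fb (lb - la).
Proof.
intros Ha Hb Hfg HF Hg Hla Hlb.
assert (HD : forall x, 0 < x -> Derive F x = g x) by (intros x Hx; apply is_derive_unique, HF, Hx).
(* Both endpoints are eventually positive, hence so is the interval between them: a property of all
   positive reals holds along the product filter. *)
assert (Hpos : forall P : R -> Prop, (forall x, 0 < x -> P x) ->
  filter_prod Fa Fb (fun ab => forall x, Rmin (fst ab) (snd ab) <= x <= Rmax (fst ab) (snd ab) -> P x)).
{ intros P HP; exists (fun x => 0 < x) (fun x => 0 < x); auto.
  intros x y Hx Hy t [Ht _]; apply HP; simpl in Ht.
  apply Rlt_le_trans with (2 := Ht); apply Rmin_glb_lt; auto. }
apply is_RInt_gen_ext with (Derive F).
- generalize (Hpos (fun x => Derive F x = f x)).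
  intros H; generalize (H (fun x Hx => eq_trans (HD x Hx) (eq_sym (Hfg x Hx)))).
  apply filter_imp; intros ab Hab x Hx; apply Hab; lra.
- apply is_RInt_gen_Derive; trivial; apply Hpos; intros x Hx.
  + exists (g x); apply HF, Hx.
  + apply continuous_ext_loc with g; [|apply Hg, Hx].
    generalize (locally_ball x (mkposreal x Hx)); apply filter_imp.
    intros y Hy; change (Rabs (y - x) < x) in Hy; apply Rabs_def2 in Hy.
    symmetry; apply HD; lra.
Qed.

Lemma RInt_gen_antiderivative (F f g : R -> R) (Fa Fb : (R -> Prop) -> Prop)
  {FFa : ProperFilter Fa} {FFb : ProperFilter Fb} (la lb : R) :
  Fa (fun x => 0 < x) -> Fb (fun x => 0 < x) ->
  (forall x, 0 < x -> f x = g x) ->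
  (forall x, 0 < x -> is_derive F x (g x)) ->
  (forall x, 0 < x -> continuous g x) ->
  filterlim F Fa (locally la) -> filterlim F Fb (locally lb) ->
  RInt_gen f Fa Fb = lb - la.
Proof.
intros; apply (is_RInt_gen_unique (V := R_CompleteNormedModule) f).
apply is_RInt_gen_antiderivative with F g; try assumption; apply filter_filter.
Qed.

Lemma filterlim_at_point (F : R -> R) (x : R) : filterlim F (at_point x) (locally (F x)).
Proof. intros P HP; exact (locally_singleton _ _ HP). Qed.

(** * The unnormalised Gamma kernel and its integral from 0 *)

Definition gker (a x : R) : R := Rpower x (a - 1) * exp (- x).

Lemma gker_pos a x : 0 < gker a x.
Proof. apply Rmult_lt_0_compat; apply exp_pos. Qed.

Lemma gker_succ a x : 0 < x -> gker (a + 1) x = x * gker a x.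
Proof.
intros Hx; unfold gker; replace (a + 1 - 1) with (a - 1 + 1) by ring.
rewrite Rpower_plus, Rpower_1 by exact Hx; ring.
Qed.

Lemma is_derive_gker a x : 0 < x -> is_derive (gker a) x (gker a x * ((a - 1) / x - 1)).
Proof.
intros Hx; unfold gker, Rpower; auto_derive; [lra|].
field; lra.
Qed.

Lemma continuous_gker a x : 0 < x -> continuous (gker a) x.
Proof.
intros Hx; apply (ex_derive_continuous (gker a)); eexists; apply is_derive_gker, Hx.
Qed.

Lemma gker_lim_infty a : filterlim (gker a) (Rbar_locally p_infty) (locally 0).
Proof.
(* The kernel is the exponential of y ((a - 1) ln y / y - 1). Since ln y / y tends to 0, the
   exponent tends to minus infinity. *)
assert (H : is_lim (fun y => exp (y * ((a - 1) * (ln y / y) - 1))) p_infty 0).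
{ apply is_lim_comp with m_infty.
  - apply is_lim_exp_m.
  - replace m_infty with (Rbar_mult p_infty (-1))
      by (simpl; destruct (Rle_dec 0 (-1)) as [h|h]; [exfalso; lra|reflexivity]).
    apply is_lim_mult.
    + apply is_lim_id.
    + replace (-1) with ((a - 1) * 0 - 1) by ring.
      apply is_lim_minus'; [|apply is_lim_const].
      exact (is_lim_scal_l _ (a - 1) _ _ is_lim_div_ln_p).
    + simpl; lra.
  - exists 0; discriminate. }
apply (is_lim_ext_loc _ (gker a)) in H; [exact H|].
exists 0; intros y Hy; unfold gker, Rpower; rewrite <- exp_plus; f_equal; field; lra.
Qed.

(** On (0, 1] the kernel is at most x: with a - 1 >= 1 and ln x <= 0, the power is at most x, and
    exp (- x) <= 1. *)
Lemma gker_lim_0 a : 2 <= a -> filterlim (gker a) (at_right 0) (locally 0).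
Proof.
intros Ha; apply filterlim_squeeze_0 with (g := fun x => x).
- apply at_right_proper_filter.
- generalize (at_right_0_below 1 Rlt_0_1); apply filter_imp; intros x Hx.
  rewrite Rabs_pos_eq by (apply Rlt_le, gker_pos).
  unfold gker; apply Rle_trans with (x * 1); [|lra].
  apply Rmult_le_compat; try (apply Rlt_le, exp_pos).
  + rewrite <- (exp_ln x) at 2 by lra; unfold Rpower.
    assert (Hl : ln x <= 0) by (rewrite <- ln_1; destruct (Req_dec x 1) as [->|]; [lra|apply Rlt_le, ln_increasing; lra]).
    destruct (Req_dec ((a - 1) * ln x) (ln x)) as [->|Hn]; [lra|apply Rlt_le, exp_increasing; nra].
  + rewrite <- exp_0; destruct (Req_dec (-x) 0) as [->|]; [lra|apply Rlt_le, exp_increasing; lra].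
- apply (filterlim_at_right (fun x => x) 0); apply filterlim_id.
Qed.

(* [gker a 0] is [exp 0 = 1], because [ln 0 = 0]; [gker0] is the continuous
   extension of the kernel by zero. *)
Definition gker0 (a x : R) : R := if Rlt_dec 0 x then gker a x else 0.

Lemma gker0_pos a x : 0 < x -> gker0 a x = gker a x.
Proof. intros Hx; unfold gker0; destruct (Rlt_dec 0 x); [reflexivity|lra]. Qed.

Lemma continuous_gker0 a x : 2 <= a -> continuous (gker0 a) x.
Proof.
intros Ha; destruct (Rtotal_order x 0) as [Hx|[->|Hx]].
- apply continuous_ext_loc with (fun _ => 0); [|apply continuous_const].
  generalize (open_lt 0 x Hx); apply filter_imp; intros y Hy.
  unfold gker0; destruct (Rlt_dec 0 y); [exfalso; lra|reflexivity].
- intros P HP.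
  assert (E : gker0 a 0 = 0) by (unfold gker0; destruct (Rlt_dec 0 0); lra).
  rewrite E in HP; generalize (gker_lim_0 a Ha P HP).
  unfold filtermap, at_right, within; apply filter_imp; intros y Hy.
  unfold gker0; destruct (Rlt_dec 0 y); [auto|apply locally_singleton, HP].
- apply continuous_ext_loc with (gker a); [|apply continuous_gker, Hx].
  generalize (open_gt 0 x Hx); apply filter_imp; intros y Hy.
  symmetry; apply gker0_pos, Hy.
Qed.

(** For a >= 2 this is a proper integral of a function continuous on all of R. The fundamental
    theorem of calculus therefore applies even at 0, which yields the limit there. *)
Definition lower_gamma (a x : R) : R := RInt (gker0 a) 0 x.

Lemma is_derive_lower_gamma a x : 2 <= a -> 0 < x ->
  is_derive (lower_gamma a) x (gker a x).
Proof.
intros Ha Hx; rewrite <- gker0_pos by exact Hx.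
apply (is_derive_RInt (gker0 a) (lower_gamma a) 0); [|apply continuous_gker0, Ha].
apply filter_forall; intros y; apply (RInt_correct (gker0 a)).
apply (ex_RInt_continuous (gker0 a)); intros; apply continuous_gker0, Ha.
Qed.

Lemma lower_gamma_lim_0 a : 2 <= a -> filterlim (lower_gamma a) (at_right 0) (locally 0).
Proof.
intros Ha; apply filterlim_at_right.
  replace (locally 0) with (locally (lower_gamma a 0)) at 2
    by (unfold lower_gamma; rewrite RInt_point; reflexivity).
  change (continuous (lower_gamma a) 0); apply (ex_derive_continuous (lower_gamma a)).
  exists (gker0 a 0).
  apply (is_derive_RInt (gker0 a) (lower_gamma a) 0); [|apply continuous_gker0, Ha].
  apply filter_forall; intros y; apply (RInt_correct (gker0 a)).
  apply (ex_RInt_continuous (gker0 a)); intros; apply continuous_gker0, Ha.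
Qed.

Lemma lower_gamma_pos a x : 2 <= a -> 0 < x -> 0 < lower_gamma a x.
Proof.
intros Ha Hx; apply RInt_gt_0; [exact Hx| |intros; apply continuous_gker0, Ha].
intros y Hy; rewrite gker0_pos by lra; apply gker_pos.
Qed.

Lemma lower_gamma_mono a x y : 2 <= a -> 0 < x <= y -> lower_gamma a x <= lower_gamma a y.
Proof.
intros Ha Hxy; apply nondecreasing_of_derive with (gker a); [lra| |]; intros t Ht.
- apply is_derive_lower_gamma; lra.
- apply Rlt_le, gker_pos.
Qed.

(** * The explicit majorants and their differential inequalities *)

Definition disc (a y : R) : R := (y - a) ^ 2 + a.

(* [e = 1] is for [M_up] to the right of [a], [e = -1] for [M_low] to the left.
   The first term is the asymptotic value that makes [M''] vanish; the second is
   chosen so that [y^2 M''] is at most [y^2 / (r D)], where [r = sqrt a]. *)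
Definition outer_majorant (e r a y : R) : R :=
  e * (y - a - 1) / disc a y + y ^ 2 / (r * disc a y ^ 2).

(* The constant makes this agree with [outer_majorant] at [y = a + e r]. *)
Definition inner_majorant (e r a y : R) : R :=
  (7 / 4 + / (4 * r ^ 2)) / r - e * (y - a) / a.

Lemma disc_pos a y : 0 < a -> 0 < disc a y.
Proof. intros Ha; unfold disc; assert (H := pow2_ge_0 (y - a)); lra. Qed.

(** Arranged so that [y * outer_majorant' e r a y - (y - a) * outer_majorant e r a y] is - e plus
    y^2 / D^2 times a bracket. In the bracket, 2 e is the defect of the first term of the majorant
    and the quotient by r comes from the second term. Only the sign of the bracket then matters. *)
Definition outer_majorant' (e r a y : R) : R :=
  ((y - a) * outer_majorant e r a y - e +
    y ^ 2 / disc a y ^ 2 *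
      (2 * e + (2 - 4 * (y - a) * y / disc a y - (y - a)) / r)) / y.

Lemma is_derive_outer_majorant e r a y : 0 < a -> 0 < r -> 0 < y ->
  is_derive (outer_majorant e r a) y (outer_majorant' e r a y).
Proof.
intros Ha Hr Hy; assert (HD := disc_pos a y Ha).
unfold outer_majorant', outer_majorant, disc in *.
auto_derive.
- replace ((y + - a) * ((y + - a) * 1) + a) with ((y - a) ^ 2 + a) by ring.
  split; [lra|split; [|trivial]].
  apply Rmult_integral_contrapositive_currified; [lra|].
  apply Rmult_integral_contrapositive_currified; lra.
- field; repeat split; lra.
Qed.

Lemma is_derive_inner_majorant e r a y : 0 < a -> 0 < r ->
  is_derive (inner_majorant e r a) y (- e / a).
Proof. intros Ha Hr; unfold inner_majorant; auto_derive; [trivial|field; lra]. Qed.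

(** At the junction D = 2 a, the terms odd in e cancel, and both sides equal (3 + 1 / r^2) / (4
    r). *)
Lemma outer_inner_majorant e r a : 0 < r -> a = r * r -> e * e = 1 ->
  outer_majorant e r a (a + e * r) = inner_majorant e r a (a + e * r).
Proof.
intros Hr -> He; unfold outer_majorant, inner_majorant, disc.
replace ((r * r + e * r - r * r) ^ 2) with ((e * e) * (r * r)) by ring.
replace ((r * r + e * r) ^ 2) with (r ^ 2 * (r ^ 2 + 2 * e * r + e * e)) by ring.
replace (e * (r * r + e * r - r * r - 1)) with (e * e * r - e) by ring.
replace (e * (r * r + e * r - r * r)) with (e * e * r) by ring.
rewrite He; field; nra.
Qed.

Lemma outer_majorant_super r a y : 0 < r -> a = r * r -> a + r <= y ->
  y * outer_majorant' 1 r a y - (y - a) * outer_majorant 1 r a y <= -1.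
Proof.
intros Hr Ha Hy.
assert (HD := disc_pos a y ltac:(nra)).
assert (Hyd : 0 <= y ^ 2 / disc a y ^ 2)
  by (apply Rdiv_le_0_compat; [apply pow2_ge_0|apply pow_lt, HD]).
enough (H : 2 + (2 - 4 * (y - a) * y / disc a y - (y - a)) / r <= 0).
{ unfold outer_majorant'.
  replace (y * _) with ((y - a) * outer_majorant 1 r a y - 1 + y ^ 2 / disc a y ^ 2 *
    (2 * 1 + (2 - 4 * (y - a) * y / disc a y - (y - a)) / r)) by (field; repeat split; nra).
  nra. }
clear HD Hyd; set (t := (y - a) / r).
assert (Ht : 1 <= t) by (apply Rmult_le_reg_r with r; [lra|unfold t; field_simplify; lra]).
assert (Ey : y = r * r + r * t) by (unfold t; rewrite Ha; field; lra).
unfold disc; clearbody t; rewrite Ha, Ey.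
replace (2 + _) with (- (((t * (1 + t ^ 2) + 4 * t - 2 * (1 + t ^ 2)) * r + (2 * t ^ 2 - 2)) / (r * (1 + t ^ 2)))) by (field; repeat split; nra).
assert (0 <= ((t * (1 + t ^ 2) + 4 * t - 2 * (1 + t ^ 2)) * r + (2 * t ^ 2 - 2)) / (r * (1 + t ^ 2))); [|lra].
apply Rdiv_le_0_compat; [|nra].
(* The cubic is t (t - 1)^2 + 4 t - 2, positive for t >= 1; the other summand 2 t^2 - 2 is
   nonnegative as well. *)
assert (0 <= t * (1 + t ^ 2) + 4 * t - 2 * (1 + t ^ 2)) by nra; nra.
Qed.

Lemma outer_majorant_sub r a y : 4 <= r -> a = r * r -> 0 < y <= a - r ->
  1 <= y * outer_majorant' (-1) r a y - (y - a) * outer_majorant (-1) r a y.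
Proof.
intros Hr Ha Hy.
assert (HD := disc_pos a y ltac:(nra)).
assert (Hyd : 0 <= y ^ 2 / disc a y ^ 2)
  by (apply Rdiv_le_0_compat; [apply pow2_ge_0|apply pow_lt, HD]).
enough (H : 0 <= -2 + (2 - 4 * (y - a) * y / disc a y - (y - a)) / r).
{ unfold outer_majorant'.
  replace (y * _) with ((y - a) * outer_majorant (-1) r a y - -1 + y ^ 2 / disc a y ^ 2 *
    (2 * -1 + (2 - 4 * (y - a) * y / disc a y - (y - a)) / r)) by (field; repeat split; nra).
  nra. }
clear HD Hyd; set (t := (a - y) / r).
assert (Ht : 1 <= t) by (apply Rmult_le_reg_r with r; [lra|unfold t; field_simplify; lra]).
assert (Ey : y = r * r - r * t) by (unfold t; rewrite Ha; field; lra).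
unfold disc; clearbody t; rewrite Ha, Ey.
replace (-2 + _) with (((t * (1 + t ^ 2) + 4 * t - 2 * (1 + t ^ 2)) * r + (2 - 2 * t ^ 2)) / (r * (1 + t ^ 2))) by (field; repeat split; nra).
apply Rdiv_le_0_compat; [|nra].
assert (0 <= t * (1 + t ^ 2) + 4 * t - 2 * (1 + t ^ 2)) by nra.
(* Left of a the summand 2 - 2 t^2 is nonpositive and must be absorbed by the cubic. The numerator
   is nondecreasing in r, so r = 4 is the worst case. *)
assert (0 <= (t * (1 + t ^ 2) + 4 * t - 2 * (1 + t ^ 2)) * 4 + (2 - 2 * t ^ 2)) by nra; nra.
Qed.

(** Since (y gker)' = - (y - a) gker, comparing [x * gker a x * f x] with an incomplete gamma
    function, whose derivative is plus or minus the kernel, reduces to comparing y f' - (y - a) f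
    with 1 or -1. *)
Lemma is_derive_gker_weighted a f f' y : 0 < y -> is_derive f y f' ->
  is_derive (fun x => x * gker a x * f x) y (gker a y * (y * f' - (y - a) * f y)).
Proof.
intros Hy Hf.
assert (Hk := is_derive_gker a y Hy).
evar_last; [apply (is_derive_mult (fun x => x * gker a x) f)|].
- apply (is_derive_mult (fun x => x) (gker a)); [apply is_derive_id|exact Hk|apply Rmult_comm].
- exact Hf.
- apply Rmult_comm.
- unfold plus, mult, one; simpl; field; lra.
Qed.

(** * Polynomial estimates behind the constant 5/2 *)

Lemma outer_bound e r a y : 0 < r -> 0 < a -> e * e = 1 ->
  disc a y * (disc a y * outer_majorant e r a y - e * (y - a - 1)) <= 5 / (2 * r) * y ^ 2.
Proof.
intros Hr Ha He; assert (HD := disc_pos a y Ha); unfold outer_majorant.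
(* The first term of the majorant cancels, and what remains is exactly y^2 / r, that is 2/5 of the
   bound. *)
replace (disc a y * _) with (2 / 5 * (5 / (2 * r) * y ^ 2)) by (field; lra).
assert (0 <= 5 / (2 * r) * y ^ 2); [|lra].
apply Rmult_le_pos; [apply Rlt_le, Rdiv_lt_0_compat; lra|apply pow2_ge_0].
Qed.

Lemma inner_bound_up r a y : 4 <= r -> a = r * r -> a <= y <= a + r ->
  disc a y * (disc a y * inner_majorant 1 r a y - (y - a - 1)) <= 5 / (2 * r) * y ^ 2.
Proof.
intros Hr Ha Hy; set (t := (y - a) / r); set (s := / r).
assert (Hs : 0 < s <= 1 / 4).
{ unfold s; split; [apply Rinv_0_lt_compat; lra|].
  replace (1 / 4) with (/ 4) by lra; apply Rinv_le_contravar; lra. }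
assert (Hrs : r * s = 1) by (unfold s; field; lra).
assert (Ht : 0 <= t <= 1).
{ unfold t; split; apply Rmult_le_reg_r with r; try lra; field_simplify; lra. }
assert (Ey : y = r * r + r * t) by (unfold t; rewrite Ha; field; lra).
unfold disc, inner_majorant; clearbody t; rewrite Ha, Ey.
replace (_ * _) with (r ^ 3 * ((1 + t ^ 2) * ((1 + t ^ 2) * (7 / 4 + s ^ 2 / 4 - t) - t + s)))
  by (unfold s; field; lra).
replace (5 / (2 * r) * _) with (r ^ 3 * (5 / 2 * (1 + s * t) ^ 2)) by (unfold s; field; lra).
apply Rmult_le_compat_l; [apply pow_le; lra|]; clear - Hs Ht.
(* From s <= 1/4, m is at most 7/4 + 1/64, rounded up to 57/32. This is still below 2, so 57/32 t -
   1 - t^2 has no real root. On the right, (1 + s t)^2 >= 1 suffices. *)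
set (m := 7 / 4 + s ^ 2 / 4); assert (m <= 57 / 32) by (unfold m; nra); clearbody m.
assert ((1 + t ^ 2) * (m - t) <= 57 / 32).
{ apply Rle_trans with ((1 + t ^ 2) * (57 / 32 - t)); [apply Rmult_le_compat_l; nra|].
  assert (57 / 32 * t - 1 - t ^ 2 <= 0) by nra; nra. }
apply Rle_trans with ((1 + t ^ 2) * (57 / 32 + 1 / 4 - t)); [nra|].
apply Rle_trans with (5 / 2); [nra|].
assert (0 <= s * t) by nra; nra.
Qed.

Lemma inner_bound_low r a y : 4 <= r -> a = r * r -> a - r <= y <= a ->
  disc a y * (disc a y * inner_majorant (-1) r a y + (y - a - 1)) <= 5 / (2 * r) * y ^ 2.
Proof.
intros Hr Ha Hy; set (t := (a - y) / r); set (s := / r).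
assert (Hs : 0 < s <= 1 / 4).
{ unfold s; split; [apply Rinv_0_lt_compat; lra|].
  replace (1 / 4) with (/ 4) by lra; apply Rinv_le_contravar; lra. }
assert (Hrs : r * s = 1) by (unfold s; field; lra).
assert (Ht : 0 <= t <= 1).
{ unfold t; split; apply Rmult_le_reg_r with r; try lra; field_simplify; lra. }
assert (Ey : y = r * r - r * t) by (unfold t; rewrite Ha; field; lra).
unfold disc, inner_majorant; clearbody t; rewrite Ha, Ey.
replace (_ * _) with (r ^ 3 * ((1 + t ^ 2) * ((1 + t ^ 2) * (7 / 4 + s ^ 2 / 4 - t) - t - s)))
  by (unfold s; field; lra).
replace (5 / (2 * r) * _) with (r ^ 3 * (5 / 2 * (1 - s * t) ^ 2)) by (unfold s; field; lra).
apply Rmult_le_compat_l; [apply pow_le; lra|]; clear - Hs Ht.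
(* Here (1 - s t)^2 may be below 1, so s cannot be discarded. Bounding s^2 / 4 by s / 16, and later
   (1 - s t)^2 by 1 - 2 s t, makes everything affine in s. *)
assert ((1 + t ^ 2) * (7 / 4 + s ^ 2 / 4 - t) <= 7 / 4 + s / 16).
{ apply Rle_trans with ((1 + t ^ 2) * (7 / 4 + s / 16 - t)); [apply Rmult_le_compat_l; nra|].
  assert (t * (t * (7 / 4 + s / 16) - 1 - t ^ 2) <= 0); [|nra].
  assert (t * (7 / 4 + s / 16) - 1 - t ^ 2 <= 0) by nra; nra. }
apply Rle_trans with ((1 + t ^ 2) * (7 / 4 - 15 / 16 * s - t)); [nra|].
apply Rle_trans with (5 / 2 - 5 * (s * t)); [|nra].
(* affine in [s], hence checked at [s = 0] and [s = 1/4] *)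
assert (E0 : (1 + t ^ 2) * (7 / 4 - t) <= 5 / 2) by nra.
assert (E1 : (1 + t ^ 2) * (7 / 4 - 15 / 64 - t) <= 5 / 2 - 5 / 4 * t) by nra.
assert (P0 : 0 <= (1 - 4 * s) * (5 / 2 - (1 + t ^ 2) * (7 / 4 - t))) by (apply Rmult_le_pos; lra).
assert (P1 : 0 <= 4 * s * (5 / 2 - 5 / 4 * t - (1 + t ^ 2) * (7 / 4 - 15 / 64 - t))) by (apply Rmult_le_pos; lra).
lra.
Qed.

(** * Convergence of the Gamma integral and the upper incomplete gamma function *)

Lemma outer_majorant_le_1 r a y : 4 <= r -> a = r * r -> a + r <= y ->
  0 <= outer_majorant 1 r a y <= 1.
Proof.
intros Hr Ha Hy; assert (HD := disc_pos a y ltac:(nra)).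
assert (Hw : r <= y - a) by lra.
assert (H1 : 0 <= 1 * (y - a - 1) / disc a y <= 1 / 2).
{ split; [apply Rdiv_le_0_compat; lra|].
  apply Rmult_le_reg_r with (disc a y); [lra|].
  replace (1 * (y - a - 1) / disc a y * disc a y) with (y - a - 1) by (field; lra).
  unfold disc; nra. }
assert (H2 : 0 <= y ^ 2 / (r * disc a y ^ 2) <= 1 / 2); [|unfold outer_majorant; lra].
assert (HD2 : 0 < disc a y ^ 2) by (apply pow_lt, HD).
split; [apply Rdiv_le_0_compat; [apply pow2_ge_0|nra]|].
apply Rmult_le_reg_r with (r * disc a y ^ 2); [nra|].
replace (y ^ 2 / (r * disc a y ^ 2) * (r * disc a y ^ 2)) with (y ^ 2) by (field; lra).
assert (y ^ 2 <= disc a y ^ 2) by (apply pow_incr; unfold disc; nra).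
nra.
Qed.

(** A crude bound, serving to show that the weighted majorant vanishes at 0. *)
Lemma outer_majorant_le_3 r a y : 4 <= r -> a = r * r -> 0 < y <= a ->
  0 <= outer_majorant (-1) r a y <= 3.
Proof.
intros Hr Ha Hy; assert (HD : a <= disc a y)
  by (unfold disc; assert (H := pow2_ge_0 (y - a)); lra).
assert (H1 : 0 <= -1 * (y - a - 1) / disc a y <= 2).
{ split; [apply Rdiv_le_0_compat; nra|].
  apply Rmult_le_reg_r with (disc a y); [nra|].
  replace (-1 * (y - a - 1) / disc a y * disc a y) with (a - y + 1) by (field; nra).
  nra. }
assert (H2 : 0 <= y ^ 2 / (r * disc a y ^ 2) <= 1); [|unfold outer_majorant; lra].
assert (HD2 : 0 < disc a y ^ 2) by (apply pow_lt; nra).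
split; [apply Rdiv_le_0_compat; [apply pow2_ge_0|nra]|].
apply Rmult_le_reg_r with (r * disc a y ^ 2); [nra|].
replace (y ^ 2 / (r * disc a y ^ 2) * (r * disc a y ^ 2)) with (y ^ 2) by (field; nra).
assert (y ^ 2 <= disc a y ^ 2) by (apply pow_incr; lra).
nra.
Qed.

(** By [outer_majorant_super], the sum of [lower_gamma] and the weighted majorant is nonincreasing
    beyond a + r, so its value at a + r is a bound. The inequality made for the tail thus also
    proves that the Gamma integral converges. *)
Lemma lower_gamma_bounded r a x : 4 <= r -> a = r * r -> 0 < x ->
  lower_gamma a x <= lower_gamma a (a + r) + (a + r) * gker a (a + r) * outer_majorant 1 r a (a + r).
Proof.
intros Hr Ha Hx; assert (Ha16 : 16 <= a) by nra.
assert (Hq : forall y, a + r <= y -> 0 <= y * gker a y * outer_majorant 1 r a y).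
{ intros y Hy; apply Rmult_le_pos; [|now apply outer_majorant_le_1].
  apply Rmult_le_pos; [lra|apply Rlt_le, gker_pos]. }
destruct (Rle_lt_dec x (a + r)) as [Hl|Hl].
- assert (H := lower_gamma_mono a x (a + r) ltac:(lra) ltac:(lra)).
  specialize (Hq (a + r)); lra.
- apply Ropp_le_cancel, Rle_trans with (- (lower_gamma a x + x * gker a x * outer_majorant 1 r a x));
    [|specialize (Hq x); lra].
  apply (nondecreasing_of_derive
    (fun y => - (lower_gamma a y + y * gker a y * outer_majorant 1 r a y))
    (fun y => - (gker a y + gker a y *
      (y * outer_majorant' 1 r a y - (y - a) * outer_majorant 1 r a y)))); [lra| |]; intros t Ht.
  + apply (is_derive_opp (fun y => lower_gamma a y + y * gker a y * outer_majorant 1 r a y)).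
    apply (is_derive_plus (lower_gamma a)); [apply is_derive_lower_gamma; lra|].
    apply is_derive_gker_weighted; [lra|apply is_derive_outer_majorant; lra].
  + assert (H := outer_majorant_super r a t ltac:(lra) Ha ltac:(lra)).
    assert (Hk := gker_pos a t); nra.
Qed.

Lemma lower_gamma_lim_infty a : 16 <= a ->
  filterlim (lower_gamma a) (Rbar_locally p_infty) (locally (Gamma a)) /\
  (forall x, 0 < x -> lower_gamma a x <= Gamma a).
Proof.
intros Ha.
assert (Hs : a = sqrt a * sqrt a) by (rewrite sqrt_sqrt; lra).
assert (H4 : 4 <= sqrt a) by (apply Rsqr_incr_0_var; [unfold Rsqr; lra|apply sqrt_pos]).
destruct (filterlim_bounded_nondecreasing (lower_gamma a) _
  (fun x y => lower_gamma_mono a x y ltac:(lra))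
  (fun x => lower_gamma_bounded (sqrt a) a x H4 Hs)) as [l [Hl Hle]].
replace (Gamma a) with l; [split; assumption|].
unfold Gamma; rewrite (RInt_gen_antiderivative (lower_gamma a) _ (gker a) _ _ 0 l).
- symmetry; exact (Rminus_0_r l).
- generalize (at_right_0_below 1 Rlt_0_1); apply filter_imp; intros; lra.
- exists 0; trivial.
- reflexivity.
- intros x Hx; apply is_derive_lower_gamma; lra.
- apply continuous_gker.
- apply lower_gamma_lim_0; lra.
- exact Hl.
Qed.

Lemma Gamma_pos a : 16 <= a -> 0 < Gamma a.
Proof.
intros Ha; apply Rlt_le_trans with (lower_gamma a 1);
  [apply lower_gamma_pos|apply lower_gamma_lim_infty]; lra.
Qed.

(** Taken as a complement rather than as an improper integral: the derivative and the sum with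
    [lower_gamma] are then immediate. [gamma_sf_eq] recovers the tail integral. *)
Definition upper_gamma (a x : R) : R := Gamma a - lower_gamma a x.

Lemma is_derive_upper_gamma a x : 2 <= a -> 0 < x ->
  is_derive (upper_gamma a) x (- gker a x).
Proof.
intros Ha Hx; evar_last.
- apply (is_derive_minus (fun _ => Gamma a) (lower_gamma a));
    [apply is_derive_const|apply is_derive_lower_gamma; assumption].
- exact (Rminus_0_l _).
Qed.

Lemma upper_gamma_nonneg a x : 16 <= a -> 0 < x -> 0 <= upper_gamma a x.
Proof.
intros Ha Hx; unfold upper_gamma.
assert (H := proj2 (lower_gamma_lim_infty a Ha) x Hx); lra.
Qed.

Lemma upper_gamma_lim_infty a : 16 <= a ->
  filterlim (upper_gamma a) (Rbar_locally p_infty) (locally 0).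
Proof.
intros Ha P [eps HP].
generalize (proj1 (lower_gamma_lim_infty a Ha) _ (locally_ball (Gamma a) eps)).
unfold filtermap; apply filter_imp; intros x Hx; apply HP.
change (Rabs (lower_gamma a x - Gamma a) < eps) in Hx.
change (Rabs (Gamma a - lower_gamma a x - 0) < eps).
rewrite Rminus_0_r, Rabs_minus_sym; exact Hx.
Qed.

(** * Comparison of the incomplete gamma functions with the majorants *)

Lemma upper_gamma_le_outer r a y : 4 <= r -> a = r * r -> a + r <= y ->
  upper_gamma a y <= y * gker a y * outer_majorant 1 r a y.
Proof.
intros Hr Ha Hy; assert (Ha16 : 16 <= a) by nra.
enough (0 <= y * gker a y * outer_majorant 1 r a y + - upper_gamma a y) by lra.
(* The difference of the two sides vanishes at infinity and is nonincreasing by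
   [outer_majorant_super]. *)
apply (nonneg_of_derive_at_infty
  (fun y => y * gker a y * outer_majorant 1 r a y + - upper_gamma a y)
  (fun y => gker a y * (y * outer_majorant' 1 r a y - (y - a) * outer_majorant 1 r a y)
    + - - gker a y)).
- intros x Hx; apply (is_derive_plus (fun y => y * gker a y * outer_majorant 1 r a y)).
  + apply is_derive_gker_weighted; [lra|apply is_derive_outer_majorant; lra].
  + apply (is_derive_opp (upper_gamma a)), is_derive_upper_gamma; lra.
- intros x Hx; assert (H := outer_majorant_super r a x ltac:(lra) Ha ltac:(lra)).
  assert (Hk := gker_pos a x); nra.
- apply filterlim_plus_0; [apply Rbar_locally_filter| |].
  + apply filterlim_squeeze_0 with (gker (a + 1)); [apply Rbar_locally_filter| |apply gker_lim_infty].
    exists (a + r); intros x Hx.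
    assert (H := outer_majorant_le_1 r a x Hr Ha ltac:(lra)).
    rewrite gker_succ by lra; assert (Hk := gker_pos a x).
    assert (0 <= x * gker a x) by nra.
    rewrite Rabs_pos_eq by nra; nra.
  + apply filterlim_squeeze_0 with (upper_gamma a);
      [apply Rbar_locally_filter| |apply upper_gamma_lim_infty, Ha16].
    exists 0; intros x Hx; rewrite Rabs_Ropp, Rabs_pos_eq; [lra|].
    now apply upper_gamma_nonneg.
Qed.

Lemma lower_gamma_le_outer r a y : 4 <= r -> a = r * r -> 0 < y <= a - r ->
  lower_gamma a y <= y * gker a y * outer_majorant (-1) r a y.
Proof.
intros Hr Ha Hy; assert (Ha16 : 16 <= a) by nra.
enough (0 <= y * gker a y * outer_majorant (-1) r a y + - lower_gamma a y) by lra.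
apply (nonneg_of_derive_at_0
  (fun y => y * gker a y * outer_majorant (-1) r a y + - lower_gamma a y)
  (fun y => gker a y * (y * outer_majorant' (-1) r a y - (y - a) * outer_majorant (-1) r a y)
    + - gker a y)); [lra| | |].
- intros x Hx; apply (is_derive_plus (fun y => y * gker a y * outer_majorant (-1) r a y)).
  + apply is_derive_gker_weighted; [lra|apply is_derive_outer_majorant; lra].
  + apply (is_derive_opp (lower_gamma a)), is_derive_lower_gamma; lra.
- intros x Hx; assert (H := outer_majorant_sub r a x Hr Ha ltac:(lra)).
  assert (Hk := gker_pos a x); nra.
- apply filterlim_plus_0; [apply at_right_proper_filter| |].
  + apply filterlim_squeeze_0 with (fun x => 3 * gker (a + 1) x);
      [apply at_right_proper_filter| |].
    * generalize (at_right_0_below a ltac:(lra)); apply filter_imp; intros x Hx.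
      assert (H := outer_majorant_le_3 r a x Hr Ha ltac:(lra)).
      rewrite gker_succ by lra; assert (Hk := gker_pos a x).
      assert (0 <= x * gker a x) by nra.
      rewrite Rabs_pos_eq by nra; nra.
    * apply filterlim_scal_0; apply gker_lim_0; lra.
  + apply filterlim_squeeze_0 with (lower_gamma a);
      [apply at_right_proper_filter| |apply lower_gamma_lim_0; lra].
    generalize (at_right_0_below 1 Rlt_0_1); apply filter_imp; intros x Hx.
    rewrite Rabs_Ropp, Rabs_pos_eq; [lra|].
    apply Rlt_le, lower_gamma_pos; lra.
Qed.


(** At a + r the majorants agree, so the outer bound gives the inequality there. The difference of
    the two sides is nonincreasing on [a, a + r], which carries it left to a. *)
Lemma upper_gamma_le_inner r a y : 4 <= r -> a = r * r -> a <= y <= a + r ->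
  upper_gamma a y <= y * gker a y * inner_majorant 1 r a y.
Proof.
intros Hr Ha Hy; assert (Ha16 : 16 <= a) by nra.
assert (H0 := upper_gamma_le_outer r a (a + r) Hr Ha ltac:(lra)).
replace (a + r) with (a + 1 * r) in H0 at 4 by ring.
rewrite outer_inner_majorant, Rmult_1_l in H0 by lra.
enough (- (y * gker a y * inner_majorant 1 r a y + - upper_gamma a y) <=
  - ((a + r) * gker a (a + r) * inner_majorant 1 r a (a + r) + - upper_gamma a (a + r))) by lra.
apply (nondecreasing_of_derive
  (fun y => - (y * gker a y * inner_majorant 1 r a y + - upper_gamma a y))
  (fun y => - (gker a y * (y * (- 1 / a) - (y - a) * inner_majorant 1 r a y)
    + - - gker a y))); [lra| |]; intros x Hx.
- apply (is_derive_opp (fun y => y * gker a y * inner_majorant 1 r a y + - upper_gamma a y)).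
  apply (is_derive_plus (fun y => y * gker a y * inner_majorant 1 r a y)).
  + apply is_derive_gker_weighted; [lra|apply is_derive_inner_majorant; lra].
  + apply (is_derive_opp (upper_gamma a)), is_derive_upper_gamma; lra.
- assert (x * (- 1 / a) - (x - a) * inner_majorant 1 r a x <= - 1).
  (* The excess over -1 is minus a product of nonnegative factors, because x - a <= r <= 7/4 r. *)
  { replace (x * _ - _) with (- 1 - (x - a) * (((7 / 4 + / (4 * r ^ 2)) * r + 1 - (x - a)) / a))
      by (unfold inner_majorant; rewrite Ha; field; lra).
    assert (0 <= (x - a) * (((7 / 4 + / (4 * r ^ 2)) * r + 1 - (x - a)) / a)); [|lra].
    assert (0 < / (4 * r ^ 2)) by (apply Rinv_0_lt_compat; nra).
    apply Rmult_le_pos; [lra|apply Rdiv_le_0_compat; nra]. }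
  assert (Hk := gker_pos a x); nra.
Qed.

Lemma lower_gamma_le_inner r a y : 4 <= r -> a = r * r -> a - r <= y <= a ->
  lower_gamma a y <= y * gker a y * inner_majorant (-1) r a y.
Proof.
intros Hr Ha Hy; assert (Ha16 : 16 <= a) by nra.
assert (H0 := lower_gamma_le_outer r a (a - r) Hr Ha ltac:(nra)).
replace (a - r) with (a + -1 * r) in H0 at 4 by ring.
rewrite outer_inner_majorant in H0 by lra.
replace (a + -1 * r) with (a - r) in H0 by ring.
enough ((a - r) * gker a (a - r) * inner_majorant (-1) r a (a - r) + - lower_gamma a (a - r) <=
  y * gker a y * inner_majorant (-1) r a y + - lower_gamma a y) by lra.
apply (nondecreasing_of_derive
  (fun y => y * gker a y * inner_majorant (-1) r a y + - lower_gamma a y)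
  (fun y => gker a y * (y * (- -1 / a) - (y - a) * inner_majorant (-1) r a y)
    + - gker a y)); [lra| |]; intros x Hx.
- assert (0 < x) by nra.
  apply (is_derive_plus (fun y => y * gker a y * inner_majorant (-1) r a y)).
  + apply is_derive_gker_weighted; [lra|apply is_derive_inner_majorant; lra].
  + apply (is_derive_opp (lower_gamma a)), is_derive_lower_gamma; lra.
- assert (1 <= x * (- -1 / a) - (x - a) * inner_majorant (-1) r a x).
  { replace (x * _ - _) with (1 + (a - x) * (((7 / 4 + / (4 * r ^ 2)) * r - 1 - (a - x)) / a))
      by (unfold inner_majorant; rewrite Ha; field; lra).
    assert (0 <= (a - x) * (((7 / 4 + / (4 * r ^ 2)) * r - 1 - (a - x)) / a)); [|lra].
    assert (0 < / (4 * r ^ 2)) by (apply Rinv_0_lt_compat; nra).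
    apply Rmult_le_pos; [lra|apply Rdiv_le_0_compat; nra]. }
  assert (Hk := gker_pos a x); nra.
Qed.

(** Supplies the decay needed for the limits of [upper_gamma1] and [upper_gamma2] at infinity. *)
Lemma upper_gamma_le_gker r a y : 4 <= r -> a = r * r -> a + r <= y ->
  0 <= upper_gamma a y <= gker (a + 1) y.
Proof.
intros Hr Ha Hy; split; [apply upper_gamma_nonneg; nra|].
assert (H := upper_gamma_le_outer r a y Hr Ha Hy).
assert (H1 := outer_majorant_le_1 r a y Hr Ha Hy).
assert (Hk := gker_pos (a + 1) y).
rewrite gker_succ in * by nra; nra.
Qed.

(** * Closed forms of the iterated integrals *)

Definition lower_gamma1 (a x : R) : R := (x - a) * lower_gamma a x + x * gker a x.

(** Twice the integral of [lower_gamma1] from 0, and at the same time [x * gker a x] times x^2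
    M_low''. The proof rests on this coincidence. *)
Definition lower_gamma2 (a x : R) : R :=
  disc a x * lower_gamma a x + (x - a - 1) * (x * gker a x).

Definition upper_gamma1 (a x : R) : R := x * gker a x - (x - a) * upper_gamma a x.

Definition upper_gamma2 (a x : R) : R :=
  disc a x * upper_gamma a x - (x - a - 1) * (x * gker a x).

Lemma is_derive_lower_gamma1 a x : 2 <= a -> 0 < x ->
  is_derive (lower_gamma1 a) x (lower_gamma a x).
Proof.
intros Ha Hx; unfold lower_gamma1.
assert (HG := is_derive_lower_gamma a x Ha Hx); assert (Hk := is_derive_gker a x Hx).
auto_derive.
- repeat split; eexists; eassumption.
- replace (Derive _ x) with (gker a x) by (symmetry; now apply is_derive_unique).
  replace (Derive _ x) with (gker a x * ((a - 1) / x - 1))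
    by (symmetry; now apply is_derive_unique).
  field; lra.
Qed.

Lemma is_derive_lower_gamma2 a x : 2 <= a -> 0 < x ->
  is_derive (lower_gamma2 a) x (2 * lower_gamma1 a x).
Proof.
intros Ha Hx; unfold lower_gamma2, lower_gamma1, disc.
assert (HG := is_derive_lower_gamma a x Ha Hx); assert (Hk := is_derive_gker a x Hx).
auto_derive.
- repeat split; eexists; eassumption.
- replace (Derive _ x) with (gker a x) by (symmetry; now apply is_derive_unique).
  replace (Derive _ x) with (gker a x * ((a - 1) / x - 1))
    by (symmetry; now apply is_derive_unique).
  field; lra.
Qed.

Lemma is_derive_upper_gamma1 a x : 2 <= a -> 0 < x ->
  is_derive (upper_gamma1 a) x (- upper_gamma a x).
Proof.
intros Ha Hx; unfold upper_gamma1.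
assert (HG := is_derive_upper_gamma a x Ha Hx); assert (Hk := is_derive_gker a x Hx).
auto_derive.
- repeat split; eexists; eassumption.
- replace (Derive (fun x0 => gker a x0) x) with (gker a x * ((a - 1) / x - 1))
    by (symmetry; now apply is_derive_unique).
  replace (Derive _ x) with (- gker a x) by (symmetry; now apply is_derive_unique).
  field; lra.
Qed.

Lemma is_derive_upper_gamma2 a x : 2 <= a -> 0 < x ->
  is_derive (upper_gamma2 a) x (- (2 * upper_gamma1 a x)).
Proof.
intros Ha Hx; unfold upper_gamma2, upper_gamma1, disc.
assert (HG := is_derive_upper_gamma a x Ha Hx); assert (Hk := is_derive_gker a x Hx).
auto_derive.
- repeat split; eexists; eassumption.
- replace (Derive _ x) with (- gker a x) by (symmetry; now apply is_derive_unique).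
  replace (Derive _ x) with (gker a x * ((a - 1) / x - 1))
    by (symmetry; now apply is_derive_unique).
  field; lra.
Qed.

Lemma lower_gamma_comb_lim_0 a (F : R -> R) (C : R) : 2 <= a ->
  (forall x, 0 < x <= 1 -> Rabs (F x) <= C * (lower_gamma a x + gker a x)) ->
  filterlim F (at_right 0) (locally 0).
Proof.
intros Ha HF.
apply filterlim_squeeze_0 with (fun x => C * (lower_gamma a x + gker a x)).
- apply at_right_proper_filter.
- generalize (at_right_0_below 1 Rlt_0_1); apply filter_imp, HF.
- apply filterlim_scal_0.
  apply filterlim_plus_0; [apply at_right_proper_filter| |].
  + apply lower_gamma_lim_0, Ha.
  + apply gker_lim_0, Ha.
Qed.

Lemma lower_gamma1_lim_0 a : 2 <= a -> filterlim (lower_gamma1 a) (at_right 0) (locally 0).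
Proof.
intros Ha; apply lower_gamma_comb_lim_0 with a (a + 1); [exact Ha|]; intros x Hx.
assert (HG := lower_gamma_pos a x Ha ltac:(lra)); assert (Hk := gker_pos a x).
unfold lower_gamma1; apply Rabs_le; split; nra.
Qed.

Lemma lower_gamma2_lim_0 a : 2 <= a -> filterlim (lower_gamma2 a) (at_right 0) (locally 0).
Proof.
intros Ha; apply lower_gamma_comb_lim_0 with a (a ^ 2 + a + 1); [exact Ha|]; intros x Hx.
assert (HG := lower_gamma_pos a x Ha ltac:(lra)); assert (Hk := gker_pos a x).
assert (0 <= disc a x <= a ^ 2 + a + 1) by (unfold disc; split; nra).
assert (- (a + 1) <= (x - a - 1) * x <= 0) by nra.
unfold lower_gamma2.
replace ((x - a - 1) * (x * gker a x)) with ((x - a - 1) * x * gker a x) by ring.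
apply Rabs_le; split; nra.
Qed.

(** Polynomial growth is absorbed by raising the shape, since x gker(a) = gker(a + 1). The uses
    below take the shapes a + 1 and a + 2. *)
Lemma gker_comb_lim_infty a (F : R -> R) (b : R) :
  (forall x, b <= x -> Rabs (F x) <= gker a x + gker (a + 1) x) ->
  filterlim F (Rbar_locally p_infty) (locally 0).
Proof.
intros HF; apply filterlim_squeeze_0 with (fun x => gker a x + gker (a + 1) x).
- apply Rbar_locally_filter.
- exists b; intros x Hx; apply HF; lra.
- apply filterlim_plus_0; [apply Rbar_locally_filter| |]; apply gker_lim_infty.
Qed.

Lemma upper_gamma1_lim_infty r a : 4 <= r -> a = r * r ->
  filterlim (upper_gamma1 a) (Rbar_locally p_infty) (locally 0).
Proof.
intros Hr Ha; apply gker_comb_lim_infty with (a + 1) (a + r); intros x Hx.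
assert (HT := upper_gamma_le_gker r a x Hr Ha Hx).
assert (Hk := gker_pos a x).
rewrite !gker_succ in * by nra.
unfold upper_gamma1; apply Rabs_le; split; nra.
Qed.

Lemma upper_gamma2_lim_infty r a : 4 <= r -> a = r * r ->
  filterlim (upper_gamma2 a) (Rbar_locally p_infty) (locally 0).
Proof.
intros Hr Ha; apply gker_comb_lim_infty with (a + 1 + 1) (a + r); intros x Hx.
assert (HT := upper_gamma_le_gker r a x Hr Ha Hx).
assert (Hq := gker_pos (a + 1) x).
assert (Eq : gker (a + 1) x = x * gker a x) by (apply gker_succ; nra).
rewrite !(gker_succ (a + 1 + 1)), !(gker_succ (a + 1)) by nra.
assert (Hd : 0 < disc a x <= x * x) by (split; [apply disc_pos; nra|unfold disc; nra]).
unfold upper_gamma2; rewrite <- Eq; set (q := gker (a + 1) x) in *; clearbody q.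
assert (0 <= disc a x * upper_gamma a x <= x * x * q).
{ split; [nra|apply Rmult_le_compat; lra]. }
assert (0 <= (x - a - 1) * q <= x * q) by nra.
apply Rabs_le; split; nra.
Qed.

(** The closed forms mix signs. Nonnegativity comes from the sign of the derivative and the
    vanishing limit at an end, here and in the next three lemmas. *)
Lemma lower_gamma1_nonneg a x : 2 <= a -> 0 < x -> 0 <= lower_gamma1 a x.
Proof.
intros Ha Hx; apply nonneg_of_derive_at_0 with (lower_gamma a);
  [exact Hx| | |apply lower_gamma1_lim_0, Ha]; intros t Ht.
- apply is_derive_lower_gamma1; lra.
- apply Rlt_le, lower_gamma_pos; lra.
Qed.

Lemma lower_gamma2_nonneg a x : 2 <= a -> 0 < x -> 0 <= lower_gamma2 a x.
Proof.
intros Ha Hx; apply nonneg_of_derive_at_0 with (fun t => 2 * lower_gamma1 a t);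
  [exact Hx| | |apply lower_gamma2_lim_0, Ha]; intros t Ht.
- apply is_derive_lower_gamma2; lra.
- assert (H := lower_gamma1_nonneg a t Ha ltac:(lra)); lra.
Qed.

Lemma upper_gamma1_nonneg r a x : 4 <= r -> a = r * r -> 0 < x -> 0 <= upper_gamma1 a x.
Proof.
intros Hr Ha Hx; apply nonneg_of_derive_at_infty with (fun t => - upper_gamma a t);
  [| |now apply upper_gamma1_lim_infty with r]; intros t Ht.
- apply is_derive_upper_gamma1; nra.
- assert (H := upper_gamma_nonneg a t ltac:(nra) ltac:(lra)); lra.
Qed.

Lemma upper_gamma2_nonneg r a x : 4 <= r -> a = r * r -> 0 < x -> 0 <= upper_gamma2 a x.
Proof.
intros Hr Ha Hx; apply nonneg_of_derive_at_infty with (fun t => - (2 * upper_gamma1 a t));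
  [| |now apply upper_gamma2_lim_infty with r]; intros t Ht.
- apply is_derive_upper_gamma2; nra.
- assert (H := upper_gamma1_nonneg r a t Hr Ha ltac:(lra)); lra.
Qed.

(** * The integrals in the definition of [C2] in terms of the closed forms *)

Lemma int0_antiderivative (F f g : R -> R) (x : R) : 0 < x ->
  (forall t, 0 < t -> f t = g t) ->
  (forall t, 0 < t -> is_derive F t (g t)) ->
  (forall t, 0 < t -> ex_derive g t) ->
  filterlim F (at_right 0) (locally 0) -> int0 f x = F x.
Proof.
intros Hx Hfg HF Hg Hlim; unfold int0.
rewrite (RInt_gen_antiderivative F f g _ _ 0 (F x)); trivial.
- exact (Rminus_0_r (F x)).
- generalize (at_right_0_below 1 Rlt_0_1); apply filter_imp; intros; lra.
- intros t Ht; apply (ex_derive_continuous g), Hg, Ht.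
- apply filterlim_at_point.
Qed.

Lemma int_infty_antiderivative (F f g : R -> R) (x : R) : 0 < x ->
  (forall t, 0 < t -> f t = g t) ->
  (forall t, 0 < t -> is_derive F t (- g t)) ->
  (forall t, 0 < t -> ex_derive g t) ->
  filterlim F (Rbar_locally p_infty) (locally 0) -> int_infty f x = F x.
Proof.
intros Hx Hfg HF Hg Hlim; unfold int_infty.
rewrite (RInt_gen_antiderivative (fun t => -1 * F t) f g _ _ (-1 * F x) 0); trivial.
- change (0 - -1 * F x = F x); ring.
- exists 0; trivial.
- intros t Ht; evar_last; [apply (is_derive_scal F), HF, Ht|].
  change (-1 * - g t = g t); ring.
- intros t Ht; apply (ex_derive_continuous g), Hg, Ht.
- apply (filterlim_at_point (fun t => -1 * F t)).
- apply filterlim_scal_0; exact Hlim.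
Qed.

Lemma gamma_pdf_gker a x : gamma_pdf a x = / Gamma a * gker a x.
Proof. unfold gamma_pdf, gker; ring. Qed.

Lemma gamma_cdf_eq a x : 2 <= a -> 0 < x -> gamma_cdf a x = / Gamma a * lower_gamma a x.
Proof.
intros Ha Hx.
apply (int0_antiderivative (fun t => / Gamma a * lower_gamma a t) _ (fun t => / Gamma a * gker a t));
  [exact Hx| | | |]; intros.
- apply gamma_pdf_gker.
- apply (is_derive_scal (lower_gamma a)), is_derive_lower_gamma; assumption.
- apply (ex_derive_scal (gker a)); eexists; apply is_derive_gker; assumption.
- apply filterlim_scal_0; apply lower_gamma_lim_0, Ha.
Qed.

Lemma gamma_cdf1_eq a x : 2 <= a -> 0 < x -> gamma_cdf1 a x = / Gamma a * lower_gamma1 a x.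
Proof.
intros Ha Hx.
apply (int0_antiderivative (fun t => / Gamma a * lower_gamma1 a t) _ (fun t => / Gamma a * lower_gamma a t));
  [exact Hx| | | |]; intros.
- apply gamma_cdf_eq; assumption.
- apply (is_derive_scal (lower_gamma1 a)), is_derive_lower_gamma1; assumption.
- apply (ex_derive_scal (lower_gamma a)); eexists; apply is_derive_lower_gamma; assumption.
- apply filterlim_scal_0; apply lower_gamma1_lim_0, Ha.
Qed.

Lemma int0_gamma_cdf1_eq a x : 2 <= a -> 0 < x ->
  int0 (gamma_cdf1 a) x = / (2 * Gamma a) * lower_gamma2 a x.
Proof.
intros Ha Hx.
apply (int0_antiderivative (fun t => / (2 * Gamma a) * lower_gamma2 a t) _
  (fun t => / (2 * Gamma a) * (2 * lower_gamma1 a t))); [exact Hx| | | |]; intros.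
- rewrite gamma_cdf1_eq, Rinv_mult by assumption; lra.
- apply (is_derive_scal (lower_gamma2 a)), is_derive_lower_gamma2; assumption.
- apply (ex_derive_scal (fun t => 2 * lower_gamma1 a t)), (ex_derive_scal (lower_gamma1 a)).
  eexists; apply is_derive_lower_gamma1; assumption.
- apply filterlim_scal_0; apply lower_gamma2_lim_0, Ha.
Qed.

Lemma gamma_sf_eq a x : 16 <= a -> 0 < x -> gamma_sf a x = / Gamma a * upper_gamma a x.
Proof.
intros Ha Hx.
apply (int_infty_antiderivative (fun t => / Gamma a * upper_gamma a t) _ (fun t => / Gamma a * gker a t));
  [exact Hx| | | |]; intros.
- apply gamma_pdf_gker.
- rewrite Ropp_mult_distr_r.
  apply (is_derive_scal (upper_gamma a)), is_derive_upper_gamma; lra.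
- apply (ex_derive_scal (gker a)); eexists; apply is_derive_gker; assumption.
- apply filterlim_scal_0; apply upper_gamma_lim_infty, Ha.
Qed.

Lemma gamma_sf1_eq r a x : 4 <= r -> a = r * r -> 0 < x ->
  gamma_sf1 a x = / Gamma a * upper_gamma1 a x.
Proof.
intros Hr Ha Hx; assert (Ha16 : 16 <= a) by nra.
apply (int_infty_antiderivative (fun t => / Gamma a * upper_gamma1 a t) _ (fun t => / Gamma a * upper_gamma a t));
  [exact Hx| | | |]; intros.
- apply gamma_sf_eq; assumption.
- rewrite Ropp_mult_distr_r.
  apply (is_derive_scal (upper_gamma1 a)), is_derive_upper_gamma1; lra.
- apply (ex_derive_scal (upper_gamma a)); eexists; apply is_derive_upper_gamma; lra.
- apply filterlim_scal_0; now apply upper_gamma1_lim_infty with r.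
Qed.

Lemma int_infty_gamma_sf1_eq r a x : 4 <= r -> a = r * r -> 0 < x ->
  int_infty (gamma_sf1 a) x = / (2 * Gamma a) * upper_gamma2 a x.
Proof.
intros Hr Ha Hx; assert (Ha16 : 16 <= a) by nra.
apply (int_infty_antiderivative (fun t => / (2 * Gamma a) * upper_gamma2 a t) _
  (fun t => / (2 * Gamma a) * (2 * upper_gamma1 a t))); [exact Hx| | | |]; intros.
- rewrite (gamma_sf1_eq r), Rinv_mult by assumption; lra.
- rewrite Ropp_mult_distr_r.
  apply (is_derive_scal (upper_gamma2 a)), is_derive_upper_gamma2; lra.
- apply (ex_derive_scal (fun t => 2 * upper_gamma1 a t)), (ex_derive_scal (upper_gamma1 a)).
  eexists; apply is_derive_upper_gamma1; lra.
- apply filterlim_scal_0; now apply upper_gamma2_lim_infty with r.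
Qed.

(** * Second derivatives of [M_low] (e = 1) and [M_up] (e = -1) *)

Lemma Derive_n_2_of_first_order (e a z : R) (M : R -> R) : 0 < z ->
  (forall y, 0 < y -> is_derive M y ((e + (y - a) * M y) / y)) ->
  Derive_n M 2 z = (e * (z - a - 1) + disc a z * M z) / z ^ 2.
Proof.
intros Hz HM; simpl.
rewrite (Derive_ext_loc _ (fun y => (e + (y - a) * M y) / y)).
(* Differentiating y M' = e + (y - a) M gives y M'' = M + (y - a - 1) M'. Substituting M' turns the
   coefficient of M into y + w^2 - w = w^2 + a = D, where w = y - a. *)
- apply is_derive_unique; assert (H := HM z Hz); auto_derive.
  + repeat split; [eexists; eassumption|lra].
  + replace (Derive _ z) with ((e + (z - a) * M z) / z)
      by (symmetry; now apply is_derive_unique).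
    unfold disc; field; lra.
- generalize (open_gt 0 z Hz); apply filter_imp; intros y Hy.
  apply is_derive_unique, HM, Hy.
Qed.

Lemma is_derive_ratio_gker e a y (F : R -> R) : 0 < y ->
  is_derive F y (e * gker a y) ->
  is_derive (fun x => F x / (x * gker a x)) y ((e + (y - a) * (F y / (y * gker a y))) / y).
Proof.
intros Hy HF; assert (Hk := is_derive_gker a y Hy); assert (Hp := gker_pos a y).
auto_derive.
- repeat split; [eexists; eassumption|eexists; eassumption|].
  apply Rmult_integral_contrapositive_currified; lra.
- replace (Derive (fun x => F x) y) with (e * gker a y) by (symmetry; now apply is_derive_unique).
  replace (Derive _ y) with (gker a y * ((a - 1) / y - 1))
    by (symmetry; now apply is_derive_unique).
  field; lra.
Qed.

Lemma is_derive_ext_pos (f g : R -> R) (y l : R) : 0 < y ->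
  (forall t, 0 < t -> f t = g t) -> is_derive f y l -> is_derive g y l.
Proof.
intros Hy Hfg; apply is_derive_ext_loc.
generalize (open_gt 0 y Hy); apply filter_imp; exact Hfg.
Qed.

Lemma M_low_eq a y : 16 <= a -> 0 < y -> M_low a y = lower_gamma a y / (y * gker a y).
Proof.
intros Ha Hy; unfold M_low; rewrite gamma_cdf_eq, gamma_pdf_gker by lra.
assert (Hp := gker_pos a y); assert (HG := Gamma_pos a Ha); field; lra.
Qed.

Lemma M_up_eq a y : 16 <= a -> 0 < y -> M_up a y = upper_gamma a y / (y * gker a y).
Proof.
intros Ha Hy; unfold M_up; rewrite gamma_sf_eq, gamma_pdf_gker by lra.
assert (Hp := gker_pos a y); assert (HG := Gamma_pos a Ha); field; lra.
Qed.

Lemma Derive_2_M_low a z : 16 <= a -> 0 < z ->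
  Derive_n (M_low a) 2 z = lower_gamma2 a z / (z * gker a z * z ^ 2).
Proof.
intros Ha Hz; rewrite (Derive_n_2_of_first_order 1 a); [|exact Hz|].
- rewrite M_low_eq by assumption; unfold lower_gamma2.
  assert (Hp := gker_pos a z); field; lra.
- intros y Hy; rewrite M_low_eq by assumption.
  apply is_derive_ext_pos with (fun x => lower_gamma a x / (x * gker a x)); [exact Hy| |].
  + intros t Ht; symmetry; apply M_low_eq; assumption.
  + apply is_derive_ratio_gker; [exact Hy|].
    rewrite Rmult_1_l; apply is_derive_lower_gamma; lra.
Qed.

Lemma Derive_2_M_up a z : 16 <= a -> 0 < z ->
  Derive_n (M_up a) 2 z = upper_gamma2 a z / (z * gker a z * z ^ 2).
Proof.
intros Ha Hz; rewrite (Derive_n_2_of_first_order (-1) a); [|exact Hz|].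
- rewrite M_up_eq by assumption; unfold upper_gamma2.
  assert (Hp := gker_pos a z); field; lra.
- intros y Hy; rewrite M_up_eq by assumption.
  apply is_derive_ext_pos with (fun x => upper_gamma a x / (x * gker a x)); [exact Hy| |].
  + intros t Ht; symmetry; apply M_up_eq; assumption.
  + apply is_derive_ratio_gker; [exact Hy|].
    replace (-1 * gker a y) with (- gker a y) by ring; apply is_derive_upper_gamma; lra.
Qed.

(** * The product formula for [C2] and the final bound *)

Lemma C2_eq r a z : 4 <= r -> a = r * r -> 0 < z ->
  C2 a z = lower_gamma2 a z * upper_gamma2 a z / (Gamma a * (z * gker a z * z ^ 2)).
Proof.
intros Hr Ha Hz; assert (Ha16 : 16 <= a) by nra; unfold C2.
rewrite Derive_2_M_up, Derive_2_M_low, int0_gamma_cdf1_eq by lra.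
rewrite (int_infty_gamma_sf1_eq r) by assumption.
(* The two summands of [C2] are equal, which cancels the factor 1/2 in the double integrals. *)
assert (Hp := gker_pos a z); assert (HG := Gamma_pos a Ha16); field; lra.
Qed.

Lemma gamma2_sum a z : lower_gamma2 a z + upper_gamma2 a z = disc a z * Gamma a.
Proof. unfold lower_gamma2, upper_gamma2, upper_gamma; ring. Qed.

Lemma upper_gamma2_bound r a z : 4 <= r -> a = r * r -> a <= z ->
  disc a z * upper_gamma2 a z <= 5 / (2 * r) * z ^ 2 * (z * gker a z).
Proof.
intros Hr Ha Hz; assert (Ha16 : 16 <= a) by nra.
(* [F] is the value at z of whichever majorant applies there; the rest uses only these two
   properties. *)
assert (HF : exists F, upper_gamma a z <= z * gker a z * F /\
  disc a z * (disc a z * F - (z - a - 1)) <= 5 / (2 * r) * z ^ 2).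
{ destruct (Rle_lt_dec z (a + r)) as [Hzr|Hzr].
  - exists (inner_majorant 1 r a z); split;
      [apply upper_gamma_le_inner|apply inner_bound_up]; lra.
  - exists (outer_majorant 1 r a z); split; [apply upper_gamma_le_outer; lra|].
    assert (H := outer_bound 1 r a z ltac:(lra) ltac:(lra) ltac:(lra)).
    rewrite Rmult_1_l in H; exact H. }
destruct HF as [F [HF1 HF2]].
assert (Hq : 0 <= z * gker a z) by (apply Rmult_le_pos; [lra|apply Rlt_le, gker_pos]).
assert (HD := disc_pos a z ltac:(lra)).
apply Rle_trans with (disc a z * (disc a z * F - (z - a - 1)) * (z * gker a z));
  [|apply Rmult_le_compat_r; assumption].
unfold upper_gamma2; rewrite (Rmult_assoc (disc a z) (_ - _)).
apply Rmult_le_compat_l; [lra|].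
assert (disc a z * upper_gamma a z <= disc a z * (z * gker a z * F))
  by (apply Rmult_le_compat_l; lra).
lra.
Qed.

Lemma lower_gamma2_bound r a z : 4 <= r -> a = r * r -> 0 < z <= a ->
  disc a z * lower_gamma2 a z <= 5 / (2 * r) * z ^ 2 * (z * gker a z).
Proof.
intros Hr Ha Hz; assert (Ha16 : 16 <= a) by nra.
assert (HF : exists F, lower_gamma a z <= z * gker a z * F /\
  disc a z * (disc a z * F + (z - a - 1)) <= 5 / (2 * r) * z ^ 2).
{ destruct (Rle_lt_dec (a - r) z) as [Hzr|Hzr].
  - exists (inner_majorant (-1) r a z); split;
      [apply lower_gamma_le_inner|apply inner_bound_low]; lra.
  - exists (outer_majorant (-1) r a z); split; [apply lower_gamma_le_outer; lra|].
    assert (H := outer_bound (-1) r a z ltac:(lra) ltac:(lra) ltac:(lra)).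
    replace (disc a z * outer_majorant (-1) r a z + (z - a - 1))
      with (disc a z * outer_majorant (-1) r a z - -1 * (z - a - 1)) by ring.
    exact H. }
destruct HF as [F [HF1 HF2]].
assert (Hq : 0 <= z * gker a z) by (apply Rmult_le_pos; [lra|apply Rlt_le, gker_pos]).
assert (HD := disc_pos a z ltac:(lra)).
apply Rle_trans with (disc a z * (disc a z * F + (z - a - 1)) * (z * gker a z));
  [|apply Rmult_le_compat_r; assumption].
unfold lower_gamma2; rewrite (Rmult_assoc (disc a z) (_ + _)).
apply Rmult_le_compat_l; [lra|].
assert (disc a z * lower_gamma a z <= disc a z * (z * gker a z * F))
  by (apply Rmult_le_compat_l; lra).
lra.
Qed.

Lemma C2_bound r a z : 4 <= r -> a = r * r -> 0 < z -> C2 a z <= 5 / (2 * r).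
Proof.
intros Hr Ha Hz; assert (Ha16 : 16 <= a) by nra; rewrite (C2_eq r) by assumption.
assert (HA := lower_gamma2_nonneg a z ltac:(lra) Hz).
assert (HB := upper_gamma2_nonneg r a z Hr Ha Hz).
assert (HG := Gamma_pos a Ha16); assert (Hs := gamma2_sum a z).
assert (Hq : 0 < z * gker a z) by (apply Rmult_lt_0_compat; [lra|apply gker_pos]).
assert (Hz2 : 0 < z ^ 2) by (apply pow_lt, Hz).
set (A := lower_gamma2 a z) in *; set (B := upper_gamma2 a z) in *.
apply Rmult_le_reg_r with (Gamma a * (z * gker a z * z ^ 2)).
{ apply Rmult_lt_0_compat; [exact HG|apply Rmult_lt_0_compat; assumption]. }
replace (A * B / _ * _) with (A * B) by (field; repeat split; nra).
replace (5 / (2 * r) * _) with (Gamma a * (5 / (2 * r) * z ^ 2 * (z * gker a z))) by ring.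
destruct (Rle_lt_dec a z) as [Hza|Hza].
- apply Rle_trans with (Gamma a * (disc a z * B)).
  (* A B <= (A + B) B because B^2 >= 0, and A + B = D Gamma(a) by [gamma2_sum]. *)
  + replace (Gamma a * (disc a z * B)) with ((A + B) * B) by (rewrite Hs; ring); nra.
  + apply Rmult_le_compat_l; [lra|apply upper_gamma2_bound; assumption].
- apply Rle_trans with (Gamma a * (disc a z * A)).
  + replace (Gamma a * (disc a z * A)) with ((A + B) * A) by (rewrite Hs; ring); nra.
  + apply Rmult_le_compat_l; [lra|apply lower_gamma2_bound; lra].
Qed.

Theorem propositionA2 : forall a : R, 16 <= a ->
  Rbar_le (e_ a) (Finite (5 / (2 * sqrt a))).
Proof.
intros a Ha; apply Lub_Rbar_correct; intros c [z [Hz ->]].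
(* Here r = sqrt a. Carrying r with a = r * r kept square roots out of the polynomial arithmetic,
   and a >= 16 becomes r >= 4. *)
apply C2_bound; [|rewrite sqrt_sqrt; lra|exact Hz].
apply Rsqr_incr_0_var; [rewrite Rsqr_sqrt; unfold Rsqr; lra|apply sqrt_pos].
Qed.
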